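(* Let \(\lambda\in\mathbb R\setminus\mathbb Q\), and define \(f_1(t)=t^{3/2}\) and \(f_2(t)=\lambda t^{3/2}+t\). Then: (i) For every \(F\in\nabla_{\mathbb Z}\text{-}\mathrm{span}(f_1,f_2)\), \(\lim_{t\to\infty}|F(t)|\in\{0,\infty\}\). (ii) There exists a set \(E\subset\mathbb N\) of positive natural density such that \(R_{f_1}(E)\cap R_{f_2}(E)\) is piecewise syndetic but not thick.
   Context: \(\mathbb N=\{1,2,\ldots\}\). For functions \(f_1,\ldots,f_k\), the full integer derivative span is \(\nabla_{\mathbb Z}\text{-}\mathrm{span}(f_1,\ldots,f_k)=\{\sum_{i=1}^k\sum_{m=0}^{M}c_{i,m}f_i^{(m)}: M\ge 0,\ c_{i,m}\in\mathbb Z\}\), where \(f^{(m)}\) is the \(m\)-th derivative. For \(E\subset\mathbb N\) and \(r\in\mathbb Z\), \(E-r=\{m\in\mathbb N: m+r\in E\}\); for \(u:\mathbb N\to\mathbb Z\), \(R_u(E)=\{n\in\mathbb N: E\cap(E-u(n))\neq\varnothing\}\); for real-valued \(f\), \(R_f(E)=R_{\lfloor f\rfloor}(E)\), i.e. with \(u(n)=\lfloor f(n)\rfloor\). A set \(E\subset\mathbb N\) has natural density \(d(E)=\lim_{N\to\infty}|E\cap\{1,\ldots,N\}|/N\) when this limit exists. A set is thick if it contains arbitrarily long intervals of consecutive integers, syndetic if it has bounded gaps, and piecewise syndetic if it is the intersection of a thick set and a syndetic set. *)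

(* Defs.v *)
From HB Require Import structures.
From mathcomp Require Import all_boot all_order all_algebra.
From mathcomp Require Import all_classical all_reals all_analysis.

Set Implicit Arguments.
Unset Strict Implicit.
Unset Printing Implicit Defensive.

Import Order.TTheory GRing.Theory Num.Theory.
Import numFieldNormedType.Exports.

Local Open Scope classical_set_scope.
Local Open Scope ring_scope.

(* Subsets of {1, 2, ...} are represented as subsets of [posnat]. *)
Definition posnat : set nat := [set n | (0 < n)%N].

(* Functions are regarded as functions on (0, +oo): the values of [F] and of the
   [f i] at t <= 0 are irrelevant, differentiation at t > 0 being local. *)
Definition nablaZ_span (R : realType) (k : nat) (f : k.-tuple (R -> R)) :
    set (R -> R) :=
  [set F | exists (M : nat) (c : 'I_k -> nat -> int), forall t : R, 0 < t ->
     F t = \sum_(i < k) \sum_(m < M.+1) (c i m)%:~R * (tnth f i)^`(m)%classic t].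

Definition shift_set (E : set nat) (r : int) : set nat :=
  posnat `&` [set m | exists2 e : nat, E e & e%:Z = m%:Z + r].

Definition return_set (u : nat -> int) (E : set nat) : set nat :=
  posnat `&` [set n | E `&` shift_set E (u n) !=set0].

Definition return_set_floor (R : realType) (f : R -> R) (E : set nat) : set nat :=
  return_set (fun n => Num.floor (f n%:R)) E.

Definition has_natural_density (R : realType) (E : set nat) (d : R) : Prop :=
  (\sum_(1 <= n < N.+1) (n \in E : nat))%N%:R / N%:R @[N --> \oo] --> d.

Definition thick (A : set nat) : Prop :=
  forall L : nat, exists2 a : nat, (0 < a)%N &
    forall i : nat, (i < L)%N -> A (a + i)%N.

Definition syndetic (A : set nat) : Prop :=
  exists g : nat, forall n : nat, (0 < n)%N ->
    exists2 i : nat, (i <= g)%N & A (n + i)%N.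

Definition piecewise_syndetic (A : set nat) : Prop :=
  exists T S : set nat, [/\ T `<=` posnat, S `<=` posnat,
    thick T, syndetic S & A = T `&` S].

Definition f1 (R : realType) : R -> R := fun t => t `^ (3 / 2).

Definition f2 (R : realType) (lambda : R) : R -> R :=
  fun t => lambda * t `^ (3 / 2) + t.

(* Main.v *)
Require Import Defs.
From HB Require Import structures.
From mathcomp Require Import all_boot all_order all_algebra.
From mathcomp Require Import all_classical all_reals all_analysis.
From mathcomp Require Import zify ring lra.

Import Order.TTheory GRing.Theory Num.Theory.
Import numFieldNormedType.Exports.

Local Open Scope classical_set_scope.
Local Open Scope ring_scope.

(** For (i), [F t] is a combination of [t^(3/2), t, t^(1/2), 1] and negative powers
    whose coefficients at [t^(3/2)] and [t^(1/2)] have the form [c + c' lambda] with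
    integers [c], [c'], where [c'] is the coefficient at [t] resp. [1]; as [lambda] is
    irrational, the lower coefficient vanishes with the higher one.

    For (ii), take [E] to be the positive multiples [m = q k] of a large even [q] with
    [{k lambda} < omega], where [omega = {h lambda}] lies in (3/10, 1/3). If [n] is in
    [R_f1(E)], then [lambda f1(n)] is within [q/3 + |lambda|] of a multiple of [q]; if
    it is also in [R_f2(E)], then [q] divides [n + floor (lambda f1(n))]. Together they
    exclude [n = q/2] modulo [q], so the intersection is not thick.

    For piecewise syndeticity, consider [n = b^2 + j] with [b = 2 q k], [k lambda]
    within [O(1/k)] of an integer and [j = O(sqrt b)]. Writing
    [d = sqrt (b^2 + j) - b], one has exactly
    [f1(n) = b^3 + 3/2 b j + (3/2 b d^2 + d^3)], whose last bracket moves slowly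
    through every bounded range. Hence it can be placed, on a window of prescribed
    length, just above a value [q K] for which [lambda (b^3 + q K)] is in [q Z + (0, 1)].
    On this window [f1(n)] and [lambda f1(n)] lie in [q Z + [0, 1)]. When moreover [q]
    divides [n], the only remaining condition concerns [floor (f2 n) lambda / q], which
    under [n -> n + q] nearly rotates by the angle [lambda + 3 q lambda^2 k]. *)

Set Implicit Arguments.
Unset Strict Implicit.
Unset Printing Implicit Defensive.

(** * Rotations by an irrational number *)

Definition fracpart {R : realType} (x : R) : R := x - (Num.floor x)%:~R.

Lemma fracpart_itv {R : realType} (x : R) : 0 <= fracpart x < 1.
Proof. by have := floor_itv x; rewrite /fracpart intrD1; lra. Qed.

Lemma fracpartE {R : realType} (x : R) (z : int) :
  0 <= x - z%:~R < 1 -> fracpart x = x - z%:~R.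
Proof.
by move=> xz; rewrite /fracpart (@floor_def _ x z)// intrD1; lra.
Qed.

Lemma fracpart_sub {R : realType} (x a : R) :
  fracpart (x - a) = fracpart x - fracpart a + (fracpart x < fracpart a)%R%:R.
Proof.
have xI := fracpart_itv x; have aI := fracpart_itv a.
have [xa|ax] := ltP (fracpart x) (fracpart a).
  rewrite (@fracpartE _ _ (Num.floor x - Num.floor a - 1)) /=;
    move: xI aI xa; rewrite /fracpart !(intrB, intrD1, rmorph1); lra.
rewrite (@fracpartE _ _ (Num.floor x - Num.floor a)) /=;
  move: xI aI ax; rewrite /fracpart !(intrB, intrD1, rmorph1); lra.
Qed.

Lemma near_int {R : realType} (x : R) : exists z : int, `|x - z%:~R| <= 1 / 2.
Proof.
have := fracpart_itv x; rewrite /fracpart => xI.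
have [h|h] := leP (fracpart x) (1 / 2).
  by exists (Num.floor x); move: h; rewrite /fracpart ler_norml; lra.
by exists (Num.floor x + 1); move: h; rewrite /fracpart ler_norml intrD1; lra.
Qed.

Lemma irrational_int_mul {R : realType} (lambda : R) (p z : int) :
  irrational lambda -> p%:~R * lambda = z%:~R -> p = 0.
Proof.
move=> irr E; apply/eqP/negP => /negP p0; apply: irr.
exists (z%:~R / p%:~R) => //.
rewrite rmorphM fmorphV /= !ratr_int -E mulrAC mulfV ?mul1r//.
by rewrite intr_eq0.
Qed.

Lemma irrational_dist {R : realType} (lambda : R) (k : nat) :
  irrational lambda -> (0 < k)%N ->
  exists2 e : R, 0 < e & forall p : int, e <= `|k%:R * lambda - p%:~R|.
Proof.
move=> irr k0; set x := k%:R * lambda.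
have xI := fracpart_itv x.
have x0 : fracpart x != 0.
  apply/eqP; rewrite /fracpart => /subr0_eq E.
  by have := @irrational_int_mul _ _ k _ irr E; lia.
have {}x0 : 0 < fracpart x by rewrite lt_neqAle eq_sym x0; lra.
exists (Num.min (fracpart x) (1 - fracpart x)); first by rewrite lt_min; lra.
move=> p; rewrite ge_min.
have [pf|fp] := leP p (Num.floor x).
  apply/orP; left; rewrite -(ler_int R) in pf.
  by rewrite ger0_norm; move: xI; rewrite /fracpart; lra.
apply/orP; right; rewrite -lezD1 -(ler_int R) intrD1 in fp.
by rewrite ler0_norm; move: xI; rewrite /fracpart; lra.
Qed.

Lemma irrational_dist_below {R : realType} (lambda : R) (K : nat) :
  irrational lambda ->
  exists2 e : R, 0 < e &
    forall k (p : int), (0 < k < K)%N -> e <= `|k%:R * lambda - p%:~R|.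
Proof.
move=> irr; elim: K => [|K [e e0 He]]; first by exists 1 => // k p; lia.
case: (posnP K) => [->|K0]; first by exists 1 => // k p; lia.
have [e' e'0 He'] := irrational_dist irr K0.
exists (Num.min e e'); first by rewrite lt_min e0.
move=> k p kK; rewrite ge_min; have [kE|kE] := eqVneq k K.
  by rewrite kE He' orbT.
by rewrite He//; lia.
Qed.

(** Pigeonhole: the fractional parts of [i * x] for [i <= N] fall into [N] boxes of length [1/N],
    and two in one box differ by less than [1/N]. *)
Lemma dirichlet {R : realType} (x : R) (N : nat) : (0 < N)%N ->
  exists k (p : int), (0 < k <= N)%N /\ `|k%:R * x - p%:~R| < N%:R^-1.
Proof.
move=> N0; have N0R : 0 < N%:R :> R by rewrite ltr0n.
have bnd (i : 'I_N.+1) : (Num.truncn (N%:R * fracpart (i%:R * x)) < N)%N.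
  have := fracpart_itv (i%:R * x) => /andP[f0 f1].
  by rewrite truncn_lt_nat ?mulr_ge0 ?ler0n// gtr_pMr.
pose g (i : 'I_N.+1) : 'I_N := Ordinal (bnd i).
have : ~~ injectiveb g.
  apply/negP => /injectiveP /leq_card; rewrite !card_ord; lia.
case/injectivePn => i [j]; wlog ij : i j / (i < j)%N.
  move=> H ij E; case: (ltngtP i j) => h; first exact: (H i j).
    by apply: (H j i) => //; rewrite eq_sym.
  by move: ij; rewrite -val_eqE /= h eqxx.
move=> _ /(congr1 val) /= E.
exists (j - i)%N, (Num.floor (j%:R * x) - Num.floor (i%:R * x)).
split; first by have := ltn_ord j; lia.
have tI k : (Num.truncn (N%:R * fracpart (k%:R * x)))%:R <= N%:R * fracpart (k%:R * x)
    < (Num.truncn (N%:R * fracpart (k%:R * x)))%:R + 1.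
  rewrite natr1; apply: truncn_itv.
  by rewrite mulr_ge0 ?ler0n//; case/andP: (fracpart_itv (k%:R * x)).
have ti := tI i; have := tI j; rewrite -E => tj.
rewrite natrB 1?ltnW// mulrBl intrB.
rewrite (_ : _ - _ = fracpart (j%:R * x) - fracpart (i%:R * x)); last by rewrite /fracpart; ring.
rewrite -(ltr_pM2l N0R) mulfV ?gt_eqF//.
rewrite -[X in X * `|_|](gtr0_norm N0R) -normrM ltr_norml; lra.
Qed.

(** [N] is taken with [1/N] below the distance from [k * lambda] to the integers for every
    [0 < k < K], which excludes these [k] in Dirichlet's theorem. *)
Lemma dirichlet_large {R : realType} (lambda : R) (K : nat) :
  irrational lambda ->
  exists k (p : int), [/\ (0 < k)%N, (K <= k)%N & `|k%:R * lambda - p%:~R| < k%:R^-1].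
Proof.
move=> irr; have [e e0 He] := irrational_dist_below K irr.
pose N := (Num.truncn e^-1).+1.
have Ne : N%:R^-1 < e.
  by rewrite invf_plt ?posrE ?ltr0n// /N truncnS_gt.
have [k [p [kN kp]]] := @dirichlet _ lambda N isT.
exists k, p; split; first by lia.
  rewrite leqNgt; apply/negP => kK.
  have : e <= `|k%:R * lambda - p%:~R| by apply: He; lia.
  lra.
apply: lt_le_trans kp _; rewrite lef_pV2 ?posrE ?ltr0n ?ler_nat; lia.
Qed.

(** A walk modulo 1 cannot jump over an arc wider than its step, and steps of size at least [rho] go
    around in about [1/rho] moves; so [g] depends on [rho] only. Negative steps are handled by
    reflection. *)
Lemma walk_hits {R : realType} (rho : R) : 0 < rho ->
  exists g : nat, forall beta c u w : R, rho <= `|beta| < w ->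
    exists (i : nat) (z : int),
      (i <= g)%N /\ u < c + i%:R * beta - z%:~R < u + w.
Proof.
move=> rho0; exists (Num.truncn rho^-1).+1.
suff pos (beta c u w : R) : rho <= beta < w ->
    exists (i : nat) (z : int), (i <= (Num.truncn rho^-1).+1)%N /\
      u < c + i%:R * beta - z%:~R < u + w.
  move=> beta c u w.
  have [b0|b0] := leP 0 beta; first by rewrite ger0_norm//; exact: pos.
  rewrite ltr0_norm// => /(pos _ (- c) (- u - w)) [i [z [ig H]]].
  by exists i, (- z); rewrite intrN; split => //; move: H; lra.
move=> bw; have b0 : 0 < beta by lra.
pose z := Num.floor (c - u) + 1; pose y := (z%:~R - (c - u)) / beta.
have zI : 0 < z%:~R - (c - u) <= 1.
  by have := floor_itv (c - u); rewrite /z !intrD1; lra.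
have y0 : 0 <= y by apply: divr_ge0; lra.
(* [y] is the real number of steps from [c] to the first translate [u + z] beyond it; move
   [(truncn y).+1] is the first one past it, by at most [beta < w]. *)
have yb : y * beta = z%:~R - (c - u) by rewrite /y divfK// gt_eqF.
exists (Num.truncn y).+1, z; split.
  rewrite ltnS; apply: le_truncn; rewrite /y.
  apply: le_trans (_ : 1 / beta <= _).
    by rewrite ler_pM2r ?invr_gt0//; lra.
  by rewrite div1r lef_pV2 ?posrE; lra.
have := truncn_itv y0 => /andP[t1 t2].
rewrite -(ler_pM2r b0) in t1; rewrite -(ltr_pM2r b0) in t2.
rewrite -natr1 in t2 *; lra.
Qed.

(** Some [k * lambda] is within [v - u] of an integer without being one; walking by this small step
    meets the arc after boundedly many moves. *)
Lemma rotation_hits {R : realType} (lambda u v : R) :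
  irrational lambda -> u < v ->
  exists C : nat, forall c : R, exists (k : nat) (z : int),
    (0 < k <= C)%N /\ u < c + k%:R * lambda - z%:~R < v.
Proof.
move=> irr uv.
pose K := (Num.truncn (v - u)^-1).+1.
have [k [p [k0 Kk kp]]] := dirichlet_large K irr.
have [e e0 He] := irrational_dist irr k0.
have [g Hg] := walk_hits e0.
exists (1 + g * k)%N => c.
have [|i [z [ig H]]] := Hg (k%:R * lambda - p%:~R) (c + lambda) u (v - u).
  rewrite He /=; apply: lt_le_trans kp _.
  rewrite invf_ple ?posrE ?ltr0n//; last by lra.
  apply: le_trans (_ : K%:R <= _); last by rewrite ler_nat.
  by rewrite ltW // /K truncnS_gt.
(* Starting the walk at [c + lambda] makes the number of rotations positive. *)
exists (1 + i * k)%N, (z + i%:Z * p); split.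
  by rewrite add1n ltn0Sn /= add1n ltnS leq_mul2r ig orbT.
rewrite intrD intrM natrD natrM -pmulrn; move: H; lra.
Qed.

(** * Return times of Bohr sets *)

(** [T] collects the points from which [A] is reached within [g] steps. It is thick by hypothesis,
    and [A] together with the complement of [T] is syndetic. *)
Lemma piecewise_syndetic_windows (A : set nat) (g : nat) : A `<=` posnat ->
  (forall L : nat, exists2 a : nat, (0 < a)%N & forall i, (i < L)%N ->
     exists2 j, (j <= g)%N & A (a + i + j)%N) ->
  piecewise_syndetic A.
Proof.
move=> Apos win.
pose T := [set n : nat | (0 < n)%N /\ exists2 j, (j <= g)%N & A (n + j)%N].
exists T, (A `|` (posnat `\` T)); split.
- by move=> n [].
- by move=> n [/Apos//|[]].
- move=> L; have [a a0 aL] := win L; exists a => // i iL.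
  by split; [lia | exact: aL].
- exists g => n n0; have [[_ [j jg Aj]]|nT] := pselect (T n).
    by exists j => //; left.
  by exists 0%N => //; rewrite addn0; right.
- apply/seteqP; split=> n.
    move=> An; split; last by left.
    by split; [exact: Apos | exists 0%N => //; rewrite addn0].
  by move=> [Tn [//|[_ /(_ Tn)]]].
Qed.

Definition bohr_multiples {R : realType} (lambda omega : R) (q : nat) : set nat :=
  [set m | [/\ (0 < m)%N, (q %| m)%N & fracpart ((m %/ q)%:R * lambda) < omega]].

(** Telescoping. The sum over [i] is the transfer function for the arc of length
    [fracpart (h * lambda)]. *)
Lemma sum_fracpart_shift {R : realType} (lambda : R) (h : nat) (x : R) :
  \sum_(i < h) fracpart ((x + 1 - i%:R) * lambda) -
    \sum_(i < h) fracpart ((x - i%:R) * lambda) =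
  fracpart ((x + 1) * lambda) - fracpart ((x + 1 - h%:R) * lambda).
Proof.
elim: h => [|h IH]; first by rewrite !big_ord0 !subr0 subrr.
rewrite !big_ord_recr /= opprD addrACA IH -natr1.
have -> : x - h%:R = x + 1 - (h%:R + 1) by ring.
by ring.
Qed.

(* For the interval length [fracpart (h * lambda)] the indicator is a coboundary
   up to a constant, so that the visits are counted exactly. *)
Lemma bohr_multiples_count {R : realType} (lambda : R) (h q N : nat) :
  (0 < q)%N ->
  let om := fracpart (h%:R * lambda) in
  (\sum_(1 <= n < N.+1) (n \in bohr_multiples lambda om q : nat))%N%:R =
  (N %/ q)%:R * om + \sum_(i < h) fracpart ((0 - i%:R) * lambda)
    - \sum_(i < h) fracpart (((N %/ q)%:R - i%:R) * lambda).
Proof.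
move=> q0 om; elim: N => [|N IH].
  by rewrite big_nil div0n mul0r add0r subrr.
rewrite big_nat_recr //= natrD IH divnS//.
have [dv|ndv] := boolP (q %| N.+1)%N; last first.
  rewrite add0n (_ : (_ \in _) = false) ?addr0//.
  by apply/negbTE/negP => /set_mem [_]; rewrite (negbTE ndv).
rewrite add1n -natr1; set M := (N %/ q)%:R.
have -> : (N.+1 \in bohr_multiples lambda om q : nat) =
    (fracpart ((M + 1) * lambda) < om)%R :> nat.
  congr nat_of_bool; apply/idP/idP => [/set_mem [_ _]|lt_om].
    by rewrite divnS// dv add1n -natr1.
  by apply/mem_set; split => //; rewrite divnS// dv add1n -natr1.
have := sum_fracpart_shift lambda h M; have := fracpart_sub ((M + 1) * lambda) (h%:R * lambda).
by rewrite -mulrBl -/om; lra.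
Qed.

Lemma bohr_multiples_density {R : realType} (lambda : R) (h q : nat) :
  (0 < q)%N -> let om := fracpart (h%:R * lambda) in
  has_natural_density (bohr_multiples lambda om q) (om / q%:R).
Proof.
move=> q0 om; rewrite /has_natural_density.
have q0R : 0 < q%:R :> R by rewrite ltr0n.
have sumI (x : R) : 0 <= \sum_(i < h) fracpart ((x - i%:R) * lambda) <= h%:R.
  apply/andP; split.
    by apply: sumr_ge0 => i _; case/andP: (fracpart_itv ((x - i%:R) * lambda)).
  rewrite -[h%:R]mul1r -[in leRHS](card_ord h) mulr_natr -sumr_const.
  by apply: ler_sum => i _; case/andP: (fracpart_itv ((x - i%:R) * lambda)) => _ /ltW.
(* Both sums in the exact count lie in [[0, h]] and the remainder of [N] modulo [q] costs at most 1,
   so the discrepancy is bounded uniformly in [N]. *)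
have bnd N : `|(\sum_(1 <= n < N.+1) (n \in bohr_multiples lambda om q : nat))%N%:R
    - N%:R * (om / q%:R)| <= h%:R + 1 :> R.
  rewrite bohr_multiples_count// -/om.
  have := sumI 0; have := sumI (N %/ q)%:R.
  have omI : 0 <= om < 1 by exact: fracpart_itv.
  have NE : N%:R = (N %/ q)%:R * q%:R + (N %% q)%:R :> R.
    by rewrite -natrM -natrD -divn_eq.
  have rI : 0 <= ((N %% q)%:R / q%:R : R) <= 1.
    apply/andP; split; first by apply: divr_ge0; exact: ler0n.
    by rewrite ler_pdivrMr// mul1r ler_nat ltnW// ltn_mod.
  have -> : N%:R * (om / q%:R) = (N %/ q)%:R * om + om * ((N %% q)%:R / q%:R).
    by rewrite NE; field; rewrite gt_eqF.
  have oI : 0 <= om * ((N %% q)%:R / q%:R) <= 1.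
    by apply/andP; split; [apply: mulr_ge0; lra | apply: mulr_ile1; lra].
  rewrite ler_norml; lra.
apply/cvgrPdist_lt => e e0.
exists (Num.truncn ((h%:R + 1) / e)).+1 => //= N /= HN.
have N0 : 0 < N%:R :> R by rewrite ltr0n; lia.
rewrite distrC -(ltr_pM2r N0) -[X in `|_| * X](gtr0_norm N0) -normrM.
rewrite mulrBl divfK ?gt_eqF// [_ * N%:R]mulrC.
apply: le_lt_trans (bnd N) _.
rewrite mulrC -ltr_pdivrMr//; apply: lt_le_trans (truncnS_gt _) _.
by rewrite ler_nat.
Qed.

Lemma return_set_bohr_dvd {R : realType} (lambda omega : R) (q : nat)
    (u : nat -> int) (n : nat) :
  (0 < q)%N -> return_set u (bohr_multiples lambda omega q) n ->
  exists v z : int, u n = q%:Z * v /\ `|v%:~R * lambda - z%:~R| < omega.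
Proof.
move=> q0 [_ [m [[m0 qm mw] [_ [e [e0 qe ew] eE]]]]].
move: qm qe mw ew eE => /dvdnP[m' ->] /dvdnP[e' ->]; rewrite !mulnK// => mw ew eE.
exists (e'%:Z - m'%:Z), (Num.floor (e'%:R * lambda) - Num.floor (m'%:R * lambda)).
split; first by move: eE; rewrite !PoszM; lia.
have := fracpart_itv (m'%:R * lambda); have := fracpart_itv (e'%:R * lambda).
move: mw ew; rewrite /fracpart !intrB -!pmulrn ltr_norml; lra.
Qed.

(** As [|zeta| < omega], the arc [[0, omega)] meets its translate by [-zeta]; a large [k] whose
    rotation lands in the overlap puts both [q k] and [q (k + v)] in the set. *)
Lemma return_set_bohrP {R : realType} (lambda omega : R) (q : nat)
    (u : nat -> int) (n : nat) (v z : int) :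
  irrational lambda -> omega <= 1 -> (0 < q)%N -> (0 < n)%N ->
  u n = q%:Z * v -> `|v%:~R * lambda - z%:~R| < omega ->
  return_set u (bohr_multiples lambda omega q) n.
Proof.
move=> irr om1 q0 n0 uE; set zeta := v%:~R * lambda - z%:~R.
rewrite ltr_norml => zI.
pose lo : R := Num.max 0 (- zeta); pose hi := Num.min omega (omega - zeta).
have lohi : lo < hi by rewrite /lo /hi gt_max !lt_min; lra.
have [C HC] := rotation_hits irr lohi.
have [K [z' [KC]]] := HC (`|v|%N%:R * lambda).
rewrite gt_max lt_min => KI.
(* Adding [|v|] keeps [k + v] positive when [v] is negative. *)
pose k := (K + `|v|)%N; pose e := absz (k%:Z + v).
have eE : e%:Z = k%:Z + v by rewrite /e /k; lia.
have eR : e%:R = k%:R + v%:~R :> R by rewrite !pmulrn eE intrD.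
have kR : k%:R = K%:R + `|v|%N%:R :> R by rewrite natrD.
split => //=; exists (k * q)%N; split.
  split; [by rewrite muln_gt0 /k; lia | exact: dvdn_mull | rewrite mulnK//].
  rewrite (@fracpartE _ _ z') kR; lra.
split; first by rewrite /posnat /= muln_gt0 /k; lia.
exists (e * q)%N; last by rewrite uE !PoszM eE; ring.
split; [by rewrite muln_gt0 /e /k; lia | exact: dvdn_mull | rewrite mulnK//].
rewrite (@fracpartE _ _ (z' + z)) eR kR ?intrD; move: zI KI; rewrite /zeta; lra.
Qed.

Lemma return_sets_not_thick {R : realType} (lambda omega : R) (h : nat) :
  omega <= 1 / 3 -> 3 * (`|lambda| + 1) < h%:R ->
  let E := bohr_multiples lambda omega h.*2 in
  ~ thick (return_set_floor (@f1 R) E `&` return_set_floor (f2 lambda) E).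
Proof.
move=> om3 hl E /(_ h.*2) [a a0 aL].
have lam0 := normr_ge0 lambda.
have h0 : (0 < h)%N by rewrite -(ltr0n R); lra.
have q0 : (0 < h.*2)%N by lia.
(* [h.*2.-1 * a] is [-a] modulo [h.*2], so [a + i] is [h] modulo [h.*2]. *)
pose i := ((h + h.*2.-1 * a) %% h.*2)%N.
have [t nE] : exists t : nat, (a + i = t * h.*2 + h)%N.
  exists ((a + i) %/ h.*2)%N; rewrite {1}(divn_eq (a + i) h.*2); congr (_ + _)%N.
  rewrite /i modnDmr addnCA -mulSn prednK// addnC [(h.*2 * a)%N]mulnC modnMDl.
  by rewrite modn_small//; lia.
have /aL [] : (i < h.*2)%N by rewrite ltn_mod.
rewrite nE; set n := (t * h.*2 + h)%N.
move=> /(return_set_bohr_dvd q0) [v [z [vE vz]]] /(return_set_bohr_dvd q0) [v2 [_ [v2E _]]].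
move: vE v2E; rewrite /f2 -/(f1 _); set F := f1 n%:R => vE v2E.
have := floor_itv F; have := floor_itv (lambda * F + n%:R).
rewrite vE v2E !intrD1 !intrM -!pmulrn.
have -> : n%:R = t%:R * h.*2%:R + h%:R :> R by rewrite -natrM -natrD.
have -> : h.*2%:R = 2 * h%:R :> R by rewrite -mul2n natrM.
pose phi := F - 2 * h%:R * v%:~R.
have -> : F = 2 * h%:R * v%:~R + phi by rewrite /phi; ring.
move: vz; set zeta := _ - z%:~R; move=> zI.
have lphi : 0 <= phi < 1 -> `|lambda * phi| <= `|lambda|.
  by move=> pI; rewrite normrM ler_piMr ?normr_ge0 ?ger0_norm; lra.
rewrite mulrDr.
have -> : lambda * (2 * h%:R * v%:~R) = 2 * h%:R * z%:~R + 2 * h%:R * zeta.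
  by rewrite /zeta; ring.
have hz : `|2 * h%:R * zeta| <= 2 * h%:R / 3.
  by rewrite normrM ger0_norm ?mulr_ge0 ?ler0n// ler_pM2l ?mulr_gt0 ?ltr0n//; lra.
move=> I2 I1; have {}lphi : `|lambda * phi| <= `|lambda| by apply: lphi; lra.
pose w := v2 - z - t%:Z.
have wE : v2%:~R = w%:~R + z%:~R + t%:R :> R by rewrite /w !intrB -pmulrn; ring.
rewrite wE in I2.
move: lphi hz; rewrite !ler_norml => lphi hz.
have h0R : 0 < h%:R :> R by rewrite ltr0n.
(* The middle term differs from [h] by at most [2h/3 + |lambda|], hence lies strictly between 1 and
   [2h]; this excludes both [w <= 0] and [w >= 1]. *)
have {}I2 : 2 * h%:R * w%:~R <= 2 * h%:R * zeta + lambda * phi + h%:R <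
    2 * h%:R * w%:~R + 1 by move: I2; lra.
have [w0|w1] := leP w 0.
  have : 2 * h%:R * w%:~R <= 0 :> R by rewrite pmulr_rle0 ?mulr_gt0// lerz0.
  by lra.
have : 2 * h%:R <= 2 * h%:R * w%:~R :> R.
  by rewrite ler_peMr ?mulr_ge0 ?ler0n// ler1z -gtz0_ge1.
by lra.
Qed.

(** * Values of f1 near squares *)

Definition sqrt_excess {R : realType} (b j : nat) : R :=
  Num.sqrt (b ^ 2 + j)%:R - b%:R.

(** What remains of [(b + d)^3] after [b^3 + 3/2 b j] when [d (2 b + d) = j]. *)
Definition f1_excess {R : realType} (b j : nat) : R :=
  3 / 2 * b%:R * sqrt_excess b j ^+ 2 + sqrt_excess b j ^+ 3.

Lemma sqrt_excess_ge0 {R : realType} (b j : nat) : 0 <= sqrt_excess b j :> R.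
Proof.
rewrite subr_ge0 -[leLHS]ger0_norm ?ler0n// -sqrtr_sqr ler_sqrt ?ler0n//.
by rewrite -natrX ler_nat leq_addr.
Qed.

Lemma sqrt_excess_eq {R : realType} (b j : nat) :
  sqrt_excess b j * (2 * b%:R + sqrt_excess b j) = j%:R :> R.
Proof.
have := @sqr_sqrtr R (b ^ 2 + j)%:R (ler0n _ _).
by rewrite /sqrt_excess natrD natrX => h; lra.
Qed.

Lemma sqrt_excess_le {R : realType} (b j i : nat) : (0 < b)%N ->
  sqrt_excess b j <= sqrt_excess b (j + i) :> R /\
  sqrt_excess b (j + i) - sqrt_excess b j <= i%:R / (2 * b%:R) :> R.
Proof.
move=> b0; have b0R : 0 < b%:R :> R by rewrite ltr0n.
have := @sqrt_excess_eq R b j; have := @sqrt_excess_eq R b (j + i).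
have := @sqrt_excess_ge0 R b j; have := @sqrt_excess_ge0 R b (j + i).
set d := sqrt_excess b j; set d' := sqrt_excess b (j + i).
rewrite natrD => d'0 d0 E' E.
have i0 : 0 <= i%:R :> R by [].
have dd : d <= d'.
  rewrite leNgt; apply/negP => lt.
  have : d' * (2 * b%:R + d') < d * (2 * b%:R + d) by apply: ltr_pM; lra.
  by lra.
split => //; rewrite ler_pdivlMr ?mulr_gt0//; nra.
Qed.

Lemma f1_square_add {R : realType} (b j : nat) :
  f1 (b ^ 2 + j)%:R =
  b%:R ^+ 3 + 3 / 2 * b%:R * j%:R + f1_excess b j :> R.
Proof.
rewrite /f1; set t : R := (b ^ 2 + j)%:R.
have t0 : 0 <= t by rewrite ler0n.
rewrite (_ : 3 / 2 = 2^-1 * 3%:R); last by rewrite mulrC.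
rewrite powRrM powR12_sqrt// powR_mulrn ?sqrtr_ge0//.
have := sqrt_excess_eq (R := R) b j => <-.
rewrite /f1_excess; have -> : Num.sqrt t = b%:R + sqrt_excess b j.
  by rewrite /sqrt_excess; ring.
by field.
Qed.

Lemma f1_excess_le {R : realType} (b j i : nat) : (0 < b)%N ->
  f1_excess b j <= f1_excess b (j + i) :> R.
Proof.
move=> b0; have [dd _] := @sqrt_excess_le R b j i b0.
have d0 := @sqrt_excess_ge0 R b j.
rewrite /f1_excess lerD// ?ler_wpM2l ?lerXn2r ?nnegrE//; lra.
Qed.

(** The difference factors through [D - d], which is at most [i / (2 b)]; the cofactor is at most
    [6 b D] because [d <= D <= b]. *)
Lemma f1_excess_sub_le {R : realType} (b j i : nat) : (0 < b)%N ->
  let D := sqrt_excess b (j + i) : R in D <= b%:R ->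
  f1_excess b (j + i) - f1_excess b j <= 3 * i%:R * D.
Proof.
move=> b0 D Db; have b0R : 0 < b%:R :> R by rewrite ltr0n.
have [] := @sqrt_excess_le R b j i b0; rewrite -/D.
have := @sqrt_excess_ge0 R b j; rewrite /f1_excess -/D.
set d := sqrt_excess b j => d0 dD Dd.
have -> : 3 / 2 * b%:R * D ^+ 2 + D ^+ 3 - (3 / 2 * b%:R * d ^+ 2 + d ^+ 3) =
  (D - d) * (3 / 2 * b%:R * (D + d) + (D ^+ 2 + D * d + d ^+ 2)) by ring.
apply: le_trans (_ : i%:R / (2 * b%:R) * (6 * b%:R * D) <= _); last first.
  by rewrite le_eqVlt; apply/orP; left; apply/eqP; field; rewrite gt_eqF.
apply: ler_pM => //; first by lra.
  have : 0 <= b%:R * (D + d) by apply: mulr_ge0; lra.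
  have : 0 <= D * d by apply: mulr_ge0; lra.
  have := sqr_ge0 D; have := sqr_ge0 d; lra.
have h1 : b%:R * (D + d) <= 2 * b%:R * D by nra.
have h2 : D ^+ 2 + D * d + d ^+ 2 <= 3 * b%:R * D by nra.
lra.
Qed.

Lemma f1_excess_unbounded {R : realType} (b : nat) (S : R) : (0 < b)%N ->
  exists j, S <= f1_excess b j.
Proof.
move=> b0; pose X := (Num.truncn `|S|).+1.
have b1R : 1 <= b%:R :> R by rewrite ler1n.
have X1R : 1 <= X%:R :> R by rewrite ler1n.
have SX : S <= X%:R by rewrite (le_trans (ler_norm _))// ltW// truncnS_gt.
(* This [j] makes [b ^ 2 + j] the square of [b + X]. *)
exists (X ^ 2 + 2 * b * X)%N.
rewrite /f1_excess; have -> : sqrt_excess b (X ^ 2 + 2 * b * X) = X%:R :> R.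
  rewrite /sqrt_excess (_ : (_ + _)%N = (b + X) ^ 2)%N; last by lia.
  by rewrite natrX sqrtr_sqr ger0_norm ?ler0n// natrD; ring.
have X2 : X%:R <= X%:R ^+ 2 :> R by rewrite expr2 ler_peMr; lra.
have X3 : 0 <= X%:R ^+ 3 :> R by rewrite exprn_ge0; lra.
have : X%:R ^+ 2 <= b%:R * X%:R ^+ 2 :> R by rewrite ler_peMl; lra.
lra.
Qed.

(** The window starts at the first [j0] where the excess reaches [S]. Just before, [b d^2 <= Smax],
    so [d] is of order [1 / sqrt b] and [L + 1] further steps raise the excess by at most
    [3 (L + 1) D <= delta] for large [b]. *)
Lemma f1_excess_window {R : realType} (Smax delta : R) (L : nat) :
  0 < Smax -> 0 < delta ->
  exists B : nat, forall (b : nat) (S : R), (B <= b)%N -> 0 < S <= Smax ->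
    exists j0 : nat, forall i, (i <= L)%N ->
      S <= f1_excess b (j0 + i) <= S + delta /\
      (j0 + i)%:R ^+ 2 <= 9 * (2 * Smax + 1) * b%:R :> R.
Proof.
move=> Sm0 dl0; pose l : R := L.+1%:R.
have l1 : 1 <= l by rewrite ler1n.
(* The three summands serve in turn to bound the growth of [d] over the window, to get [D <= b], and
   to get [3 l D <= delta]. *)
pose B := (Num.truncn (l ^+ 2 + (2 * Smax + 1) +
   9 * l ^+ 2 * (2 * Smax + 1) / delta ^+ 2)).+1.
exists B => b S Bb SI.
have b0 : (0 < b)%N by apply: leq_trans Bb.
have b1R : 1 <= b%:R :> R by rewrite ler1n.
have : l ^+ 2 + (2 * Smax + 1) + 9 * l ^+ 2 * (2 * Smax + 1) / delta ^+ 2 <= b%:R.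
  by apply: le_trans (ltW (truncnS_gt _)) _; rewrite ler_nat.
have t1 : 0 <= l ^+ 2 by rewrite exprn_ge0; lra.
have t3 : 0 <= 9 * l ^+ 2 * (2 * Smax + 1) / delta ^+ 2.
  by rewrite divr_ge0 ?mulr_ge0 ?exprn_ge0; lra.
move=> bB; have bl : l ^+ 2 <= b%:R by lra.
have bS : 2 * Smax + 1 <= b%:R by lra.
have bd : 9 * l ^+ 2 * (2 * Smax + 1) <= b%:R * delta ^+ 2.
  by rewrite -ler_pdivrMr ?exprn_gt0//; lra.
pose P j := S <= f1_excess b j.
have exP : exists j, P j by exact: f1_excess_unbounded.
case: (ex_minnP exP) => j0 Sj0 j0min.
(* The excess vanishes at 0 while [S > 0], so [j0] has a predecessor [j1], where the excess is still
   below [S]. *)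
have [j1 j1E] : exists j1, j0 = j1.+1.
  case: j0 Sj0 {j0min} => [|j1 _]; last by exists j1.
  have -> : P 0%N = (S <= (0 : R)); last by lra.
  rewrite /P; congr (_ <= _).
  rewrite /f1_excess (_ : sqrt_excess b 0 = 0) ?expr0n /= ?mulr0 ?addr0//.
  rewrite /sqrt_excess addn0 natrX sqrtr_sqr ger0_norm ?ler0n//.
  by rewrite subrr.
have Sj1 : f1_excess b j1 < S.
  by rewrite ltNge; apply/negP => /j0min; rewrite j1E ltnn.
exists j0.
have [] := @sqrt_excess_le R b j1 L.+1 b0.
have := @f1_excess_sub_le R b j1 L.+1 b0.
have := @sqrt_excess_ge0 R b j1; move: (Sj1); rewrite {1}/f1_excess.
set d0 := sqrt_excess b j1; set D := sqrt_excess b (j1 + L.+1).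
rewrite /= -/l => Sd d00 Hex dD Dd.
have D0 : 0 <= D by lra.
have d03 : 0 <= d0 ^+ 3 by rewrite exprn_ge0.
have d02 : b%:R * d0 ^+ 2 <= Smax.
  have : 0 <= b%:R * d0 ^+ 2 by rewrite mulr_ge0// exprn_ge0.
  by lra.
pose e := l / (2 * b%:R).
have be2 : b%:R * e ^+ 2 <= 1 / 4.
  have -> : b%:R * e ^+ 2 = l ^+ 2 / b%:R / 4 by rewrite /e; field; rewrite gt_eqF; lra.
  have : l ^+ 2 / b%:R <= 1 by rewrite ler_pdivrMr; lra.
  lra.
have bD2 : b%:R * D ^+ 2 <= 2 * Smax + 1.
  have De : D ^+ 2 <= 2 * d0 ^+ 2 + 2 * e ^+ 2.
    apply: le_trans (_ : (d0 + e) ^+ 2 <= _).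
      by rewrite lerXn2r ?nnegrE; rewrite /e; lra.
    by have := sqr_ge0 (d0 - e); lra.
  have : b%:R * D ^+ 2 <= b%:R * (2 * d0 ^+ 2 + 2 * e ^+ 2) by rewrite ler_pM2l; lra.
  lra.
have Db : D <= b%:R.
  have : D ^+ 2 <= b%:R ^+ 2.
    have : b%:R * D ^+ 2 <= b%:R * b%:R ^+ 2.
      apply: le_trans bD2 _; apply: le_trans bS _.
      by rewrite ler_peMr ?exprn_ege1//; lra.
    by rewrite ler_pM2l//; lra.
  by rewrite ler_sqr ?nnegrE//; lra.
have lD : 3 * l * D <= delta.
  rewrite -ler_sqr ?nnegrE ?mulr_ge0//; try lra.
  have : b%:R * (3 * l * D) ^+ 2 <= b%:R * delta ^+ 2.
    apply: le_trans bd; rewrite (_ : _ * _ = 9 * l ^+ 2 * (b%:R * D ^+ 2)); last by ring.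
    by apply: ler_wpM2l => //; rewrite mulr_ge0//; lra.
  by rewrite ler_pM2l//; lra.
have {}Hex := Hex Db.
move=> i iL; have jE : (j1 + L.+1 = j0 + i + (L - i))%N.
  by rewrite -addnA subnKC// j1E addSnnS.
have m1 := @f1_excess_le R b j0 i b0.
have m2 := @f1_excess_le R b (j0 + i) (L - i) b0.
split.
  by rewrite (le_trans Sj0)//= (le_trans m2)// -jE; lra.
have jD : (j0 + i)%:R <= 3 * b%:R * D.
  apply: le_trans (_ : (j1 + L.+1)%:R <= _); first by rewrite ler_nat jE leq_addr.
  have <- := @sqrt_excess_eq R b (j1 + L.+1); rewrite -/D mulrC ler_wpM2r//; lra.
apply: le_trans (_ : (3 * b%:R * D) ^+ 2 <= _).
  by rewrite lerXn2r ?nnegrE ?mulr_ge0 ?ler0n//; lra.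
rewrite (_ : _ ^+ 2 = 9 * b%:R * (b%:R * D ^+ 2)); last by ring.
rewrite [leRHS]mulrAC ler_wpM2l//; lra.
Qed.

(* The angles [th k] in the conclusion satisfy [2 * th k - th (2 k) = lambda], so
   they cannot both be close to integers for [k] and [2 k]. *)
Lemma good_multiplier {R : realType} (lambda : R) (q : nat) :
  irrational lambda -> exists2 rho : R, 0 < rho & forall K : nat,
  exists k (p : int), [/\ (0 < k)%N, (K <= k)%N,
    `|k%:R * lambda - p%:~R| <= 4 / k%:R &
    forall z : int,
      rho <= `|lambda + 3 * q%:R * lambda ^+ 2 * k%:R - z%:~R|].
Proof.
move=> irr; have [e e0 He] := @irrational_dist _ _ 1 irr isT.
exists (e / 3); first by lra.
move=> K; have [k [p [k0 Kk kp]]] := dirichlet_large K irr.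
have k0R : 0 < k%:R :> R by rewrite ltr0n.
have ki0 : 0 < k%:R^-1 :> R by rewrite invr_gt0.
have [H|] := pselect (forall z : int,
  e / 3 <= `|lambda + 3 * q%:R * lambda ^+ 2 * k%:R - z%:~R|).
  by exists k, p; split => //; lra.
move=> /existsNP[z /negP]; rewrite -ltNge => zI.
(* Doubling an approximation within [1/k] gives [2/k = 4/(2k)], whence the constant 4. *)
exists (k.*2), (2 * p); split; [lia|lia| |].
  rewrite -mul2n natrM intrM -mulrA -mulrBr normrM ger0_norm//.
  rewrite (_ : 4 / (2 * k%:R) = 2 * k%:R^-1); last by field; rewrite gt_eqF.
  by rewrite ler_pM2l//; lra.
move=> z'; rewrite leNgt; apply/negP => z'I.
have := He (2 * z - z'); rewrite intrB intrM mul1r.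
rewrite leNgt => /negP; apply.
move: zI z'I; rewrite -mul2n natrM !ltr_norml; lra.
Qed.

(** * Common return times on a window *)

Lemma f1_window {R : realType} (q k K j : nat) :
  f1 ((2 * q * k) ^ 2 + j)%:R =
  q%:R * (8 * q ^ 2 * k ^ 3 + 3 * k * j + K)%N%:R +
    (f1_excess (2 * q * k) j - q%:R * K%:R) :> R.
Proof.
rewrite f1_square_add !(natrD, natrM, natrX); by field.
Qed.

(** The two expansions give [q (v lambda - z) = e - lambda sigma], of size at most 9/8, whereas
    [q omega >= 30]. *)
Lemma return_f1_window {R : realType} (lambda omega : R) (q n : nat)
    (v z : int) (sigma e : R) :
  irrational lambda -> 3 / 10 <= omega <= 1 -> 100 * (`|lambda| + 1) <= q%:R ->
  (0 < n)%N -> 0 <= sigma <= 1 / 8 -> `|lambda * sigma| <= 1 / 8 -> 0 < e < 1 ->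
  f1 n%:R = q%:R * v%:~R + sigma -> lambda * f1 n%:R = q%:R * z%:~R + e ->
  return_set_floor (@f1 R) (bohr_multiples lambda omega q) n.
Proof.
move=> irr omI qI n0 sI lsI eI FE lFE; have l0 := normr_ge0 lambda.
have q0R : 0 < q%:R :> R by lra.
apply: (@return_set_bohrP _ _ _ _ _ _ v z) => //.
- by lra.
- by rewrite -(ltr0n R).
- apply: floor_def; rewrite FE intrD1 intrM -pmulrn; lra.
have : q%:R * (v%:~R * lambda - z%:~R) = e - lambda * sigma.
  by have : lambda * f1 n%:R = lambda * (q%:R * v%:~R + sigma);
    [rewrite FE | rewrite lFE; lra].
move=> E; rewrite -(ltr_pM2l q0R) -[X in X * `|_| < _](gtr0_norm q0R) -normrM E.
have : 30 <= q%:R * omega by apply: le_trans (_ : 100 * (3 / 10) <= _); [lra | apply: ler_pM; lra].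
move: lsI; rewrite ler_norml ltr_norml; lra.
Qed.

(** Here [floor (f2 n)] is [q (z + N)]. Replacing [z] by [lambda f1(n) / q] costs [e lambda / q], at
    most 1/100, and 28/100 is below [omega]. *)
Lemma return_f2_window {R : realType} (lambda omega : R) (q N n : nat)
    (z z2 : int) (e : R) :
  irrational lambda -> 3 / 10 <= omega <= 1 -> 100 * (`|lambda| + 1) <= q%:R ->
  (0 < n)%N -> n = (q * N)%N -> 0 < e < 1 ->
  lambda * f1 n%:R = q%:R * z%:~R + e ->
  `|lambda ^+ 2 * f1 n%:R / q%:R + N%:R * lambda - z2%:~R| <= 27 / 100 ->
  return_set_floor (f2 lambda) (bohr_multiples lambda omega q) n.
Proof.
move=> irr omI qI n0 nE eI lFE cI; have l0 := normr_ge0 lambda.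
have q0R : 0 < q%:R :> R by lra.
apply: (@return_set_bohrP _ _ _ _ _ _ (z + N%:Z) z2) => //.
- by lra.
- by rewrite -(ltr0n R).
- apply: floor_def; rewrite /f2 -/(f1 _) lFE nE natrM.
  by rewrite intrD1 intrM intrD -!pmulrn; lra.
have -> : (z + N%:Z)%:~R * lambda - z2%:~R =
  lambda ^+ 2 * f1 n%:R / q%:R + N%:R * lambda - z2%:~R - e * lambda / q%:R.
  have -> : lambda ^+ 2 * f1 n%:R = lambda * (lambda * f1 n%:R) by ring.
  by rewrite lFE intrD -pmulrn; field; rewrite gt_eqF.
have : `|e * lambda / q%:R| <= 1 / 100.
  rewrite normrM normfV (gtr0_norm q0R) ler_pdivrMr// normrM gtr0_norm; last by lra.
  have : e * `|lambda| <= `|lambda| by rewrite ler_piMl//; lra.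
  lra.
move: cI; rewrite !ler_norml ltr_norml; lra.
Qed.

(** Controls the error of replacing [k lambda] by an integer in [3 q k lambda j]: [x] is [O(1/k)]
    and [j] is [O(sqrt k)]. The constant is 64 times 288. *)
Lemma drift_bound {R : realType} (q k x j W : R) :
  0 < k -> 18432 * q ^+ 3 * W <= k -> `|x| <= 4 / k ->
  j ^+ 2 <= W * (2 * q * k) -> `|3 * q * x * j| <= 1 / 8.
Proof.
move=> k0 kW xk jW; rewrite -ler_sqr ?nnegrE; [|exact: normr_ge0|lra].
rewrite real_normK ?num_real//.
have x2 : x ^+ 2 <= (4 / k) ^+ 2.
  rewrite -(real_normK (num_real x)) lerXn2r ?nnegrE//.
  by rewrite divr_ge0// ltW.
apply: le_trans (_ : 9 * q ^+ 2 * ((4 / k) ^+ 2 * (W * (2 * q * k))) <= _).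
  rewrite [leLHS](_ : _ = 9 * q ^+ 2 * (x ^+ 2 * j ^+ 2)); last by ring.
  apply: ler_wpM2l; first by rewrite mulr_ge0// sqr_ge0.
  by apply: ler_pM => //; exact: sqr_ge0.
rewrite [leLHS](_ : _ = 288 * q ^+ 3 * W / k); last by field; rewrite gt_eqF.
by rewrite ler_pdivrMr//; lra.
Qed.

Lemma return_sets_piecewise_syndetic {R : realType} (lambda omega : R) (q : nat) :
  irrational lambda -> 3 / 10 <= omega <= 1 -> 100 * (`|lambda| + 1) <= q%:R ->
  let E := bohr_multiples lambda omega q in
  piecewise_syndetic (return_set_floor (@f1 R) E `&` return_set_floor (f2 lambda) E).
Proof.
move=> irr omI qI E; have l0 := normr_ge0 lambda.
have q0R : 0 < q%:R :> R by lra.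
have q0 : (0 < q)%N by rewrite -(ltr0n R).
have [rho rho0 Hrho] := good_multiplier q irr.
have [g Hg] := walk_hits rho0.
have [|C HC] := @rotation_hits _ lambda (1 / 4 / q%:R) (3 / 4 / q%:R) irr.
  by rewrite ltr_pM2r ?invr_gt0//; lra.
(* Fewer than [q] steps reach a multiple of [q], then at most [g] jumps of length [q] follow; [g] is
   fixed before [L]. *)
apply: (@piecewise_syndetic_windows _ (q * g + q)); first by move=> n [[]].
move=> L; pose L' := (L + (q * g + q))%N.
(* Makes [delta], [|lambda| delta] and [lambda^2 delta] all at most 1/8. *)
pose delta : R := 1 / 8 / (`|lambda| + 1) ^+ 2.
have l12 : 1 <= (`|lambda| + 1) ^+ 2 by rewrite exprn_ege1; lra.
have dl0 : 0 < delta by rewrite divr_gt0; lra.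
have dE : delta * (`|lambda| + 1) ^+ 2 = 1 / 8 by rewrite /delta divfK// gt_eqF; lra.
have dl1 : delta <= 1 / 8.
  by rewrite -dE ler_peMr; lra.
have dl2 : `|lambda| * delta <= 1 / 8.
  rewrite -dE mulrC ler_pM2l// (le_trans (_ : _ <= `|lambda| + 1)); [lra|lra|].
  by rewrite expr2 ler_peMr; lra.
have dl3 : lambda ^+ 2 * delta <= 1 / 8.
  rewrite -dE mulrC ler_pM2l// -(real_normK (num_real lambda)).
  by rewrite lerXn2r ?nnegrE; lra.
pose Smax : R := q%:R * C.+1%:R.
have Sm0 : 0 < Smax by rewrite mulr_gt0 ?ltr0n.
have [B HB] := f1_excess_window L' Sm0 dl0.
pose W : R := 9 * (2 * Smax + 1).
have W0 : 0 < W by rewrite /W; lra.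
pose K0 := (B + (Num.truncn (18432 * q%:R ^+ 3 * W)).+1)%N.
have [k [p [k0 K0k kp kth]]] := Hrho K0.
have k0R : 0 < k%:R :> R by rewrite ltr0n.
have kW : 18432 * q%:R ^+ 3 * W <= k%:R.
  apply: le_trans (ltW (truncnS_gt _)) _; rewrite ler_nat.
  by rewrite (leq_trans _ K0k)// leq_addl.
have [b bE] : exists b, b = (2 * q * k)%N by eexists.
have [A AE] : exists A, A = (8 * q ^ 2 * k ^ 3)%N by eexists.
have Bb : (B <= b)%N.
  apply: (@leq_trans k); first by rewrite (leq_trans _ K0k)// leq_addr.
  by rewrite bE leq_pmull// muln_gt0.
have [K [z [KC Kz]]] := HC (A%:R * lambda).
(* The margin of 1/4 on each side absorbs the drift and [lambda * sg t], each at most 1/8, so that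
   [e t] stays in [(0, 1)]. *)
have Kz' : 1 / 4 < q%:R * ((A%:R + K%:R) * lambda - z%:~R) < 3 / 4.
  move: Kz; rewrite -mulrDl => /andP[h1 h2].
  by rewrite [q%:R * _]mulrC -ltr_pdivrMr// h1 -ltr_pdivlMr.
have [|j0 Hj0] := HB b (q%:R * K%:R) Bb.
  case/andP: KC => K1 KC.
  by rewrite mulr_gt0 ?ltr0n//= ler_pM2l// ler_nat (leq_trans KC).
have b0 : (0 < b)%N by rewrite bE !muln_gt0 q0 k0.
exists (b ^ 2 + j0)%N; first by rewrite addn_gt0 expn_gt0 b0.
move=> i iL.
have [r rq [N0 N0E]] : exists2 r, (r < q)%N &
    exists N0, (b ^ 2 + j0 + i + r = q * N0)%N.
  exists ((q.-1 * (b ^ 2 + j0 + i)) %% q)%N; first by rewrite ltn_mod.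
  suff /dvdnP[N0 ->] : (q %| b ^ 2 + j0 + i + (q.-1 * (b ^ 2 + j0 + i)) %% q)%N.
    by exists N0; rewrite mulnC.
  by rewrite /dvdn modnDmr -mulSn prednK// modnMr.
have [jt jtE] : exists jt : nat -> nat, forall t, jt t = (j0 + (i + r + q * t))%N.
  by eexists => t.
have nE t : (b ^ 2 + jt t = q * (N0 + t))%N.
  by rewrite mulnDr -N0E jtE !addnA.
have [sg sgE] : exists sg : nat -> R, forall t,
    sg t = f1_excess b (jt t) - q%:R * K%:R by eexists => t.
have [F FE FE'] : exists2 F : nat -> R, forall t, F t = f1 (b ^ 2 + jt t)%:R &
    forall t, F t = q%:R * (A%:R + 3 * k%:R * (jt t)%:R + K%:R) + sg t.
  exists (fun t => f1 (b ^ 2 + jt t)%:R) => // t.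
  by rewrite sgE bE (f1_window _ _ K) AE !natrD !natrM.
have tL t : (t <= g)%N -> (i + r + q * t <= L')%N.
  move=> tg; rewrite /L' -addnA; apply: leq_add; first exact: ltnW.
  by rewrite addnC; apply: leq_add; [rewrite leq_mul2l tg orbT | exact: ltnW].
have sgI t : (t <= g)%N -> 0 <= sg t <= delta.
  move=> /tL /Hj0 [/andP[h1 h2] _].
  by rewrite sgE subr_ge0 lerBlDl jtE h1 h2.
have lsg t : (t <= g)%N -> `|lambda * sg t| <= 1 / 8.
  move=> /sgI /andP[s0 s1]; rewrite normrM (ger0_norm s0).
  by apply: le_trans dl2; rewrite ler_wpM2l.
have drift t : (t <= g)%N -> `|3 * q%:R * (k%:R * lambda - p%:~R) * (jt t)%:R| <= 1 / 8.
  move=> /tL /Hj0 [_]; rewrite -jtE -/W bE !natrM.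
  exact: drift_bound.
pose e t := q%:R * ((A%:R + K%:R) * lambda - z%:~R) +
  3 * q%:R * (k%:R * lambda - p%:~R) * (jt t)%:R + lambda * sg t.
have eI t : (t <= g)%N -> 0 < e t < 1.
  move=> tg; move: (drift t tg) (lsg t tg) Kz'; rewrite /e !ler_norml.
  by clear; lra.
have lFE t : lambda * F t = q%:R * (z + 3 * p * (jt t)%:Z)%:~R + e t.
  rewrite FE' /e intrD !intrM -!pmulrn; ring.
(* Raising [t] by 1 raises [j] by [q], hence [F] by [3 q^2 k] up to the change of [sg], and the
   quantity tested for [f2] by nearly [th]. *)
pose c := lambda ^+ 2 * F 0%N / q%:R + N0%:R * lambda.
pose th := lambda + 3 * q%:R * lambda ^+ 2 * k%:R.
have [z3 z3I] := near_int th.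
(* The step [th - z3] may be as large as 1/2, so the target arc has length 52/100; it still fits
   inside [(-omega, omega)]. *)
have [|t [z2 [tg tI]]] := Hg (th - z3%:~R) c (- (26 / 100)) (52 / 100).
  by rewrite kth /=; move: z3I; clear; lra.
exists (r + q * t)%N.
  by rewrite addnC; apply: leq_add; [rewrite leq_mul2l tg orbT | exact: ltnW].
have -> : (b ^ 2 + j0 + i + (r + q * t) = b ^ 2 + jt t)%N by rewrite jtE !addnA.
have n0 : (0 < b ^ 2 + jt t)%N by rewrite addn_gt0 expn_gt0 b0.
have sI := sgI _ tg; have eIt := eI _ tg.
have s0I := sgI 0%N isT.
move: (FE' t) (lFE t); rewrite FE => FEt lFEt.
split.
  apply: (return_f1_window irr omI qI n0 _ (lsg _ tg) eIt _ lFEt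
    (v := (A + 3 * k * jt t + K)%N)).
    by move: sI dl1; clear; lra.
  by rewrite FEt -pmulrn !(natrD, natrM).
apply: (return_f2_window irr omI qI n0 (nE t) eIt lFEt (z2 := z2 + t%:Z * z3)).
rewrite -FE.
have -> : lambda ^+ 2 * F t / q%:R + (N0 + t)%:R * lambda - (z2 + t%:Z * z3)%:~R =
   (c + t%:R * (th - z3%:~R) - z2%:~R) + lambda ^+ 2 * (sg t - sg 0%N) / q%:R.
  rewrite /c /th !FE' !jtE muln0 addn0 intrD intrM -pmulrn !(natrD, natrM).
  by field; rewrite gt_eqF.
have : `|lambda ^+ 2 * (sg t - sg 0%N) / q%:R| <= 1 / 100.
  rewrite normrM normfV (gtr0_norm q0R) ler_pdivrMr// normrM.
  rewrite (ger0_norm (sqr_ge0 lambda)).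
  have : lambda ^+ 2 * `|sg t - sg 0%N| <= lambda ^+ 2 * delta.
    by rewrite ler_wpM2l ?sqr_ge0// ler_norml; move: sI s0I; clear; lra.
  by move: dl3 qI l0; clear; lra.
by move: tI; clear; rewrite !ler_norml; lra.
Qed.

(** * Limits of derivative combinations *)

Lemma powR_cvgy {R : realType} (p : R) : 0 < p -> t `^ p @[t --> +oo] --> +oo.
Proof.
move=> p0; apply/cvgryPge => A; near=> t.
have t0 : 0 <= t by near: t; exact: nbhs_pinfty_ge.
have At : `|A| `^ p^-1 <= t by near: t; apply: nbhs_pinfty_ge; exact: num_real.
apply: le_trans (ler_norm A) _.
rewrite -[leLHS]powRr1// -(mulVf (lt0r_neq0 p0)) powRrM.
by apply: ge0_ler_powR; rewrite ?nnegrE ?powR_ge0// ltW.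
Unshelve. all: by end_near. Qed.

Lemma powR_cvg0y {R : realType} (c p : R) : 0 < p ->
  c * t `^ (- p) @[t --> +oo] --> (0 : R).
Proof.
move=> p0; apply/cvgrPdist_lt => e e0.
have /cvgryPgt/(_ (`|c| / e)) := powR_cvgy p0.
apply: filterS => t ct; have tp0 : 0 < t `^ p.
  by apply: le_lt_trans ct; rewrite divr_ge0// ltW.
rewrite sub0r normrN normrM powRN normfV (gtr0_norm tp0).
by rewrite ltr_pdivrMr// mulrC -ltr_pdivrMr.
Qed.

Lemma sum_powR_cvg0y {R : realType} (n : nat) (c p : nat -> R) :
  (forall m, 0 < p m) ->
  \sum_(m < n) c m * t `^ (- p m) @[t --> +oo] --> (0 : R).
Proof.
move=> p0; elim: n => [|n IH].
  under eq_fun do rewrite big_ord0; exact: cvg_cst.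
under eq_fun do rewrite big_ord_recr /=.
have := cvgD IH (powR_cvg0y (c n) (p0 n)); rewrite addr0; exact.
Qed.

Lemma norm_powR_mul_cvgy {R : realType} (p l : R) (G : R -> R) :
  0 < p -> l != 0 -> G t @[t --> +oo] --> l ->
  `|t `^ p * G t| @[t --> +oo] --> +oo.
Proof.
move=> p0 l0 Gl; have nl0 : 0 < `|l| by rewrite normr_gt0.
apply/cvgryPge => A.
have /cvgryPge/(_ (`|A| / (`|l| / 2))) := powR_cvgy p0.
have l20 : 0 < `|l| / 2 by lra.
have nG : `|G t| @[t --> +oo] --> `|l| by exact: cvg_norm.
have /(_ _ _ l20) := (cvgrPdist_lt _ _).1 nG.
apply: filterS2 => t.
rewrite ltr_norml => Gt tA.
apply: le_trans (ler_norm A) _.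
rewrite normrM (ger0_norm (powR_ge0 _ _)).
rewrite ler_pdivrMr ?divr_gt0// in tA.
apply: le_trans tA _; apply: ler_wpM2l; first exact: powR_ge0.
by move: Gt; lra.
Qed.

Definition lin_deriv {R : realType} (m : nat) (t : R) : R :=
  match m with 0%N => t | 1%N => 1 | _ => 0 end.

(** One family covers both functions: [f1] is the case [(1, 0)] of [(lam, mu)] and [f2] the case
    [(lambda, 1)]. *)
Lemma derive1n_powR_lin {R : realType} (a lam mu : R) (m : nat) (t : R) : 0 < t ->
  (fun t => lam * t `^ a + mu * t)^`(m)%classic t =
  lam * (\prod_(i < m) (a - i%:R)) * t `^ (a - m%:R) + mu * lin_deriv m t.
Proof.
elim: m t => [|m IH] t t0.
  by rewrite derive1n0 big_ord0 mulr1 subr0.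
rewrite derive1nS derive1E.
pose C := lam * \prod_(i < m) (a - i%:R).
rewrite (@near_eq_derive _ _ _ _
  ((C \*: (@powR R ^~ (a - m%:R))) \+ (mu \*: @lin_deriv R m))); last first.
  near=> s; rewrite IH//.
  by near: s; exact: lt_nbhsr.
have D1 := is_derive1_powR (a - m%:R) t0.
have D2 : is_derive t 1 (@lin_deriv R m) (@lin_deriv R m.+1 t).
  case: m {IH C D1} => [|[|m]] /=.
  - exact: is_derive_id.
  - exact: is_derive_cst.
  - exact: is_derive_cst.
have -> := derive_val (is_derive := is_deriveD (is_deriveZ C D1) (is_deriveZ mu D2)).
rewrite /= big_ord_recr /= /C /GRing.scale /= -natr1.
have -> : a - (m%:R + 1) = a - m%:R - 1 by ring.
ring.
Unshelve. all: by end_near. Qed.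

Lemma nablaZ_span_f1_f2 {R : realType} (lambda : R) (F : R -> R) :
  nablaZ_span [tuple @f1 R; f2 lambda] F ->
  exists (M : nat) (c1 c2 : nat -> int), forall t, 0 < t ->
    F t = \sum_(m < M.+2) (((c1 m)%:~R + (c2 m)%:~R * lambda) *
       (\prod_(i < m) (3 / 2 - i%:R)) * t `^ (3 / 2 - m%:R) +
       (c2 m)%:~R * lin_deriv m t).
Proof.
case=> M [c Fc].
(* One zero coefficient is appended so that the terms [m = 0] and [m = 1] always exist. *)
exists M, (fun m => if (m <= M)%N then c ord0 m else 0),
  (fun m => if (m <= M)%N then c (lift ord0 ord0) m else 0) => t t0.
rewrite Fc// big_ord_recl big_ord1 -big_split /= [RHS]big_ord_recr /= ltnn.
rewrite !mul0r add0r !mul0r addr0 addr0; apply: eq_bigr => m _.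
rewrite -ltnS ltn_ord.
have -> : tnth [tuple @f1 R; f2 lambda] ord0 = fun t => 1 * t `^ (3 / 2) + 0 * t.
  by apply/funext => s; rewrite mul1r mul0r addr0.
have -> : tnth [tuple @f1 R; f2 lambda] (lift ord0 ord0) =
    fun t => lambda * t `^ (3 / 2) + 1 * t.
  by apply/funext => s; rewrite mul1r.
rewrite !derive1n_powR_lin//; ring.
Qed.

Lemma nablaZ_span_limit {R : realType} (lambda : R) (F : R -> R) :
  irrational lambda -> nablaZ_span [tuple @f1 R; f2 lambda] F ->
  (`|F t| @[t --> +oo] --> (0 : R)) \/ (`|F t| @[t --> +oo] --> +oo).
Proof.
move=> irr /nablaZ_span_f1_f2 [M [c1 [c2 Fc]]].
have indep m : (c1 m)%:~R + (c2 m)%:~R * lambda = 0 -> c2 m = 0.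
  move=> E; apply: (@irrational_int_mul _ lambda _ (- c1 m) irr).
  by rewrite intrN; lra.
pose a m := (c1 m)%:~R + (c2 m)%:~R * lambda.
pose e m := a m.+2 * \prod_(i < m.+2) (3 / 2 - i%:R).
pose p m : R := m%:R + 1 / 2.
pose rest t := \sum_(m < M) e m * t `^ (- p m).
have rest0 : rest t @[t --> +oo] --> (0 : R).
  apply: sum_powR_cvg0y => m; rewrite /p.
  by have : 0 <= m%:R :> R by []; lra.
(* The orders [m = 0, 1] give the nonnegative powers; order [m + 2] has exponent
   [3/2 - (m + 2) = - p m]. *)
have FE t : 0 < t -> F t = a 0%N * t `^ (3 / 2) + (c2 0%N)%:~R * t +
    (3 / 2 * a 1%N * t `^ (1 / 2) + (c2 1%N)%:~R) + rest t.
  move=> t0; rewrite Fc// 2!big_ord_recl /= -/(a 0%N) -/(a 1%N) addrA.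
  congr (_ + _ + _).
  - by rewrite big_ord0 mulr1 subr0.
  - rewrite big_ord_recl big_ord0 /= mulr1 subr0 mulr1; congr (_ + _).
    by rewrite (_ : 3 / 2 - 1 = 1 / 2); [ring | field].
  - apply: eq_bigr => m _; rewrite mulr0 addr0 /e /a; congr (_ * _ * _ `^ _).
    by rewrite /p /bump /= !add1n -!natr1; field.
have cvg_pos (G : R -> R) (P : set_system R) :
    (forall t, 0 < t -> `|F t| = G t) -> G t @[t --> +oo] --> P ->
    `|F t| @[t --> +oo] --> P.
  move=> FG; apply: cvg_trans; apply: near_eq_cvg; near=> s.
  by rewrite FG//; near: s; exact: nbhs_pinfty_gt.
have pw (t : R) (x y z : R) : 0 < t -> x + y = z -> t `^ x * t `^ y = t `^ z.
  by move=> t0 <-; rewrite powRD// (lt0r_neq0 t0) implybT.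
have half0 : 0 < 1 / 2 :> R by lra.
have [a0|a0] := eqVneq (a 0%N) 0; last first.
  (* The dominant power is factored out, leaving a factor that tends to [a 0]; the [1 *] matches the
     form [c * t^(-p)] of the null limits. *)
  right; apply: (cvg_pos (fun t => `|t `^ (3 / 2) * (a 0%N +
    (c2 0%N)%:~R * t `^ (- (1 / 2)) + 3 / 2 * a 1%N * t `^ (- 1) +
    (c2 1%N)%:~R * t `^ (- (3 / 2)) + rest t * (1 * t `^ (- (3 / 2))))|)).
    move=> t t0; rewrite FE//; congr `| _ |.
    have h1 : t `^ (3 / 2) * t `^ (- (1 / 2)) = t.
      by rewrite (pw _ _ _ 1)// ?powRr1// ?ltW//; field.
    have h2 : t `^ (3 / 2) * t `^ (- 1) = t `^ (1 / 2) by apply: pw => //; field.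
    have h3 : t `^ (3 / 2) * t `^ (- (3 / 2)) = 1.
      by rewrite (pw _ _ _ 0)// ?powRr0//; field.
    have expand X u w y : X * (a 0%N + (c2 0%N)%:~R * u + 3 / 2 * a 1%N * w +
        (c2 1%N)%:~R * y + rest t * (1 * y)) = a 0%N * X + (c2 0%N)%:~R * (X * u) +
        3 / 2 * a 1%N * (X * w) + ((c2 1%N)%:~R + rest t) * (X * y) by ring.
    by rewrite expand h1 h2 h3; ring.
  have p32 : 0 < 3 / 2 :> R by lra.
  apply: (norm_powR_mul_cvgy (l := a 0%N)) => //.
  have := cvgD (cvgD (cvgD (cvgD (cvg_cst (a 0%N))
    (powR_cvg0y (c2 0%N)%:~R half0)) (powR_cvg0y (3 / 2 * a 1%N) ltr01))
    (powR_cvg0y (c2 1%N)%:~R p32)) (cvgM rest0 (powR_cvg0y 1 p32)).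
  by rewrite mulr0 !addr0; exact.
have [a1|a1] := eqVneq (a 1%N) 0; last first.
  right; apply: (cvg_pos (fun t => `|t `^ (1 / 2) * (3 / 2 * a 1%N +
    (c2 1%N)%:~R * t `^ (- (1 / 2)) + rest t * (1 * t `^ (- (1 / 2))))|)).
    move=> t t0; rewrite FE// a0 (indep _ a0); congr `| _ |.
    have h : t `^ (1 / 2) * t `^ (- (1 / 2)) = 1.
      by rewrite (pw _ _ _ 0)// ?powRr0//; field.
    have expand X y : X * (3 / 2 * a 1%N + (c2 1%N)%:~R * y + rest t * (1 * y)) =
        3 / 2 * a 1%N * X + ((c2 1%N)%:~R + rest t) * (X * y) by ring.
    by rewrite expand h; ring.
  have l0 : 3 / 2 * a 1%N != 0 by rewrite mulf_neq0//; lra.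
  apply: (norm_powR_mul_cvgy half0 l0).
  have := cvgD (cvgD (cvg_cst (3 / 2 * a 1%N))
    (powR_cvg0y (c2 1%N)%:~R half0)) (cvgM rest0 (powR_cvg0y 1 half0)).
  by rewrite mulr0 !addr0; exact.
left; apply: (cvg_pos (fun t => `|rest t|)).
  by move=> t t0; rewrite FE// a0 a1 (indep _ a0) (indep _ a1) !(mul0r, mulr0, add0r).
by have := cvg_norm rest0; rewrite normr0; exact.
Unshelve. all: by end_near. Qed.

Unset Implicit Arguments.

Theorem theorem1p5 (R : realType) (lambda : R)
    (lambda_irrational : irrational lambda) :
  (forall F : R -> R, nablaZ_span [tuple @f1 R; f2 lambda] F ->
     (`|F t| @[t --> +oo] --> (0 : R)) \/ (`|F t| @[t --> +oo] --> +oo)) /\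
  (exists E : set nat,
     [/\ E `<=` posnat,
         exists2 d : R, 0 < d & has_natural_density E d,
         piecewise_syndetic
           (return_set_floor (@f1 R) E `&` return_set_floor (f2 lambda) E)
       & ~ thick (return_set_floor (@f1 R) E `&` return_set_floor (f2 lambda) E)]).
Proof.
split=> [F|]; first exact: nablaZ_span_limit.
(* The upper bound 1/3 serves non-thickness, the lower bound 3/10 piecewise syndeticity. *)
have [|C HC] := @rotation_hits _ lambda (3 / 10) (1 / 3) lambda_irrational.
  by lra.
have [h [z [_ hz]]] := HC 0; rewrite add0r in hz.
have omE : 3 / 10 < fracpart (h%:R * lambda) < 1 / 3.
  by rewrite (@fracpartE _ _ z); lra.
(* Ensures [q = 2 h'] is at least [100 (|lambda| + 1)], and [h'] exceeds [3 (|lambda| + 1)]. *)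
pose h' := (Num.truncn (50 * (`|lambda| + 1))).+1.
have l0 := normr_ge0 lambda.
have h'I : 50 * (`|lambda| + 1) < h'%:R by exact: truncnS_gt.
have q0 : (0 < h'.*2)%N by rewrite double_gt0.
exists (bohr_multiples lambda (fracpart (h%:R * lambda)) h'.*2); split.
- by move=> m [].
- exists (fracpart (h%:R * lambda) / h'.*2%:R).
    by rewrite divr_gt0 ?ltr0n//; lra.
  exact: bohr_multiples_density.
- apply: return_sets_piecewise_syndetic => //; first by lra.
  by rewrite -mul2n natrM; lra.
- by apply: return_sets_not_thick; lra.
Qed.
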